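(* Let $u:\mathbb{Z}^d\to\mathbb{R}$ be harmonic. Then for all $t\ge 0$, $$Q_{c,u}(2t)\le\sqrt{Q_{c,u}(t)\,Q_{c,u}(4t)} .$$
   Context: A function $u:\mathbb{Z}^d\to\mathbb{R}$ is harmonic if $\Delta u\equiv0$, where $(\Delta u)(x)=\frac{1}{2d}\sum_{y\sim x}(u(y)-u(x))$ and $y\sim x$ means nearest neighbours. $(Y_t)_{t\ge0}$ is the rate-one continuous time simple random walk on $\mathbb{Z}^d$ starting at $0$ (generator $\Delta$), and $Q_{c,u}(t):=\mathbb{E}(u(Y_t)^2)\in[0,\infty]$. The value $+\infty$ is allowed, with $\infty\cdot a=\infty$ for $a>0$ (including $a=\infty$) and $\sqrt\infty=\infty$; the product $0\cdot\infty$ (should it be considered) is taken to be $0$. *)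

(* Defs.v *)
From HB Require Import structures.
From mathcomp Require Import all_boot all_order all_algebra.
From mathcomp Require Import all_classical all_reals all_analysis.

Set Implicit Arguments.
Unset Strict Implicit.
Unset Printing Implicit Defensive.

Import Order.TTheory GRing.Theory Num.Theory.
Import numFieldNormedType.Exports.

Local Open Scope classical_set_scope.
Local Open Scope ring_scope.

Notation lattice d := 'rV[int]_d.

(* The 2d unit vectors of Z^d: (i, false) stands for e_i, (i, true) for - e_i;
   the nearest neighbours of x are the points x + unit_step s. *)
Definition unit_step (d : nat) (s : 'I_d * bool) : lattice d :=
  (-1) ^+ s.2 *: delta_mx 0 s.1.

Definition laplacian (R : realType) (d : nat) (u : lattice d -> R)
    (x : lattice d) : R :=
  (2 * d)%:R^-1 * \sum_(s : 'I_d * bool) (u (x + unit_step s) - u x).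

Definition harmonic_function (R : realType) (d : nat) (u : lattice d -> R) : Prop :=
  forall x, laplacian u x = 0.

(* All random variables below take countably many values, so that
   measurability and independence are tested on the events {X = v}. *)
Definition discrete_rv (disp : measure_display) (T : measurableType disp)
    (V : Type) (X : T -> V) : Prop :=
  forall v, measurable [set w | X w = v].

Definition mutually_independent (disp : measure_display)
    (T : measurableType disp) (R : realType) (P : probability T R)
    (I : eqType) (V : Type) (X : I -> T -> V) : Prop :=
  forall (J : seq I) (v : I -> V), uniq J ->
    P [set w | forall i, i \in J -> X i w = v i] =
    (\prod_(i <- J) P [set w | X i w = v i])%E.

(* poisson_pmf has a junk value at rate 0, hence the strict inequality s < t
   in the law of the increments. *)
Record poisson_process (disp : measure_display) (T : measurableType disp)
    (R : realType) (P : probability T R) (rate : R) (N : R -> T -> nat) :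
    Prop := PoissonProcess {
  poisson_measurable : forall t : R, 0 <= t -> discrete_rv (N t) ;
  poisson_start : forall w, N 0 w = 0%N ;
  poisson_monotone : forall w (s t : R), 0 <= s -> s <= t -> (N s w <= N t w)%N ;
  poisson_right_continuous : forall w (t : R), 0 <= t ->
    \forall s \near t^'+, N s w = N t w ;
  poisson_increments_independent : forall t : nat -> R, 0 <= t 0%N ->
    (forall i, t i <= t i.+1) ->
    mutually_independent P (fun i w => (N (t i.+1) w - N (t i) w)%N) ;
  poisson_increments_law : forall (s t : R) k, 0 <= s -> s < t ->
    P [set w | (N t w - N s w)%N = k] = (poisson_pmf (rate * (t - s)) k)%:E
}.

Record simple_steps (disp : measure_display) (T : measurableType disp)
    (R : realType) (P : probability T R) (d : nat)
    (xi : nat -> T -> lattice d) : Prop := SimpleSteps {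
  steps_measurable : forall i, discrete_rv (xi i) ;
  steps_independent : mutually_independent P xi ;
  steps_law : forall i (s : 'I_d * bool),
    P [set w | xi i w = unit_step s] = ((2 * d)%:R^-1)%:E
}.

Definition independent_processes (disp : measure_display)
    (T : measurableType disp) (R : realType) (P : probability T R) (d : nat)
    (N : R -> T -> nat) (xi : nat -> T -> lattice d) : Prop :=
  forall (J : seq R) (k : R -> nat) (K : seq nat) (v : nat -> lattice d),
    (forall t, t \in J -> 0 <= t) ->
    let A := [set w | forall t, t \in J -> N t w = k t] in
    let B := [set w | forall i, i \in K -> xi i w = v i] in
    P (A `&` B) = (P A * P B)%E.

(* Y_t = S_(N_t), where S is the discrete time simple random walk from 0 and N
   is an independent rate-one Poisson process: Y waits an exponential time of
   mean 1 and jumps to a uniform neighbour, so its generator is [laplacian].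
   Times are real numbers, and negative times are irrelevant. *)
Definition continuous_time_srw (disp : measure_display)
    (T : measurableType disp) (R : realType) (P : probability T R) (d : nat)
    (Y : R -> T -> lattice d) : Prop :=
  exists (N : R -> T -> nat) (xi : nat -> T -> lattice d),
    [/\ poisson_process P 1 N,
        simple_steps P xi,
        independent_processes P N xi &
        forall t w, 0 <= t -> Y t w = \sum_(i < N t w) xi i w].

Definition Qc (disp : measure_display) (T : measurableType disp)
    (R : realType) (P : probability T R) (d : nat)
    (Y : R -> T -> lattice d) (u : lattice d -> R) (t : R) : \bar R :=
  ('E_P[fun w => (u (Y t w) ^+ 2)%R])%E.

(* Main.v *)
(* Write [L] for the Laplacian and [M = 1 + L] for the average over the
   neighbours.  If [u] is harmonic then [L (u^2)] is the average of the squares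
   of the harmonic functions [u (_ + e) - u], [e] a unit step, so by induction
   [L^k (u^2) >= 0].  Expanding [M^n] by the binomial formula, with [Pois(t)]
   the law of the number of jumps up to time [t],
     E u(Y_t)^2 = sum_n Pois(t){n} (M^n (u^2))(0)
                = sum_k t^k / k! (L^k (u^2))(0),
   and the inequality is Cauchy-Schwarz for this series with nonnegative
   coefficients: [(2t)^k] is the geometric mean of [t^k] and [(4t)^k]. *)
Require Import Defs.
From mathcomp Require Import all_boot all_order all_algebra.
From mathcomp Require Import all_classical all_reals all_analysis.
From mathcomp Require Import measurable_realfun.
From mathcomp Require Import ring.

Set Implicit Arguments.
Unset Strict Implicit.
Unset Printing Implicit Defensive.

Import Order.TTheory GRing.Theory Num.Theory.
Import numFieldNormedType.Exports.

Local Open Scope classical_set_scope.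
Local Open Scope ring_scope.

(** * The lattice Laplacian, its iterates and the neighbour average *)

Section Laplacian.
Context {R : realType} {d : nat}.
Implicit Types (g : lattice d -> R) (x : lattice d).

Lemma iter_laplacian_sum k (I : finType) (c : R) (g : I -> lattice d -> R) x :
  iter k (@laplacian R d) (fun y => c * \sum_i g i y) x =
  c * \sum_i iter k (@laplacian R d) (g i) x.
Proof.
elim: k x => // k IH x; rewrite !iterS /laplacian.
under eq_bigr do rewrite !IH -mulrBr -sumrB.
rewrite -mulr_sumr exchange_big /= mulrCA; congr (_ * _).
by rewrite mulr_sumr.
Qed.

Lemma harmonic_shift_sub (u : lattice d -> R) (v : lattice d) :
  harmonic_function u -> harmonic_function (fun y => u (y + v) - u y).
Proof.
move=> hu x; have := hu (x + v); have := hu x; rewrite /laplacian => hx hxv.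
rewrite (eq_bigr (fun s => (u (x + v + unit_step s) - u (x + v)) -
    (u (x + unit_step s) - u x))); last by move=> s _; rewrite (addrAC x v); ring.
by rewrite sumrB mulrBr hx hxv subr0.
Qed.

Lemma laplacian_sqr (u : lattice d -> R) x : harmonic_function u ->
  laplacian (fun y => u y ^+ 2) x =
  (2 * d)%:R^-1 * \sum_s (u (x + unit_step s) - u x) ^+ 2.
Proof.
move=> hu; have := hu x; rewrite /laplacian => hux.
(* Here [a^2 - b^2 = (a - b)^2 + 2b(a - b)], and the last term averages to zero because [u] is
   harmonic at [x]. *)
rewrite (eq_bigr (fun s => (u (x + unit_step s) - u x) ^+ 2 +
  (2 * u x) * (u (x + unit_step s) - u x))); last by move=> s _; ring.
by rewrite big_split /= -mulr_sumr mulrDr mulrCA hux mulr0 addr0.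
Qed.

(** Induction for all harmonic [u] at once, since each step passes from [u] to its increments. *)
Lemma iter_laplacian_sqr_ge0 k (u : lattice d -> R) x : harmonic_function u ->
  0 <= iter k (@laplacian R d) (fun y => u y ^+ 2) x.
Proof.
elim: k u => [u hu|k IH u hu]; first exact: sqr_ge0.
rewrite iterSr (_ : laplacian _ = fun y =>
  (2 * d)%:R^-1 * \sum_s (u (y + unit_step s) - u y) ^+ 2).
  rewrite iter_laplacian_sum mulr_ge0 ?invr_ge0// sumr_ge0// => s _.
  exact/IH/harmonic_shift_sub.
by apply/funext => y; exact: laplacian_sqr.
Qed.

Definition neighbour_mean g x : R :=
  (2 * d)%:R^-1 * \sum_(s : 'I_d * bool) g (x + unit_step s).

Lemma neighbour_meanE g x : (0 < d)%N ->
  neighbour_mean g x = g x + laplacian g x.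
Proof.
move=> d0; rewrite /laplacian sumrB mulrBr.
rewrite sumr_const card_prod card_ord card_bool (mulnC d).
rewrite -(mulr_natl (g x)) mulKf ?subrKC//; last first.
  by rewrite pnatr_eq0 muln_eq0 -lt0n d0.
Qed.

(** Pascal's rule, shaped as the induction step of the binomial formula for [(1 + L)^n], with [a k]
    in the role of [L^k g x]. *)
Lemma sum_bin_succ n (a : nat -> R) :
  \sum_(k < n.+2) 'C(n.+1, k)%:R * a k =
  \sum_(k < n.+1) 'C(n, k)%:R * (a k + a k.+1).
Proof.
under [RHS]eq_bigr do rewrite mulrDr.
rewrite big_split/= big_ord_recl/= bin0.
under eq_bigr do rewrite /bump leq0n add1n binS natrD mulrDl.
rewrite big_split/= addrA; congr (_ + _).
rewrite big_ord_recr/= bin_small// mul0r addr0 [RHS]big_ord_recl/= bin0.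
by congr (_ + _); apply: eq_bigr => i _; rewrite /bump leq0n add1n.
Qed.

Lemma iter_neighbour_mean n g x : (0 < d)%N ->
  iter n neighbour_mean g x =
  \sum_(k < n.+1) 'C(n, k)%:R * iter k (@laplacian R d) g x.
Proof.
move=> d0; elim: n x => [|n IH] x; first by rewrite big_ord1 bin0 mul1r.
rewrite iterS /neighbour_mean.
under eq_bigr do rewrite IH.
rewrite exchange_big mulr_sumr (sum_bin_succ n (fun k => iter k _ g x)).
apply: eq_bigr => k _; rewrite -mulr_sumr mulrCA; congr (_ * _).
exact: neighbour_meanE.
Qed.

(** By splitting off the first step: it selects a neighbour of [x], and the remaining steps form a
    path started there. *)
Lemma sum_steps n g x :
  \sum_(p : n.-tuple ('I_d * bool))
    g (x + \sum_(i < n) unit_step (tnth p i)) / (2 * d)%:R ^+ n =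
  iter n neighbour_mean g x.
Proof.
elim: n x => [|n IH] x.
  rewrite (big_pred1 [tuple])/= ?big_ord0 ?addr0 ?expr0 ?divr1// => p.
  by rewrite (tuple0 p); apply/esym/eqP.
rewrite iterS /neighbour_mean mulr_sumr.
rewrite (reindex (fun q : ('I_d * bool) * n.-tuple ('I_d * bool) =>
  [tuple of q.1 :: q.2]))/=; last first.
  exists (fun p : n.+1.-tuple _ => (thead p, [tuple of behead p])) => [[s p] _|p _].
    by congr (_, _); exact: val_inj.
  by rewrite [RHS]tuple_eta.
rewrite -(pair_bigA _ (fun s (p : n.-tuple ('I_d * bool)) =>
   g (x + \sum_(i < n.+1) unit_step (tnth [tuple of s :: p] i)) / (2 * d)%:R ^+ n.+1))/=.
apply: eq_bigr => s _; rewrite -IH mulr_sumr; apply: eq_bigr => p _.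
rewrite big_ord_recl tnth0 addrA exprS invfM mulrCA.
by under eq_bigr do rewrite tnthS.
Qed.

End Laplacian.

(** * Poisson mixtures and Cauchy-Schwarz for exponential series *)

Section PoissonMixture.
Context {R : realType}.
Local Open Scope ereal_scope.

Lemma poisson_pmf_sum1 (t : R) : (0 < t)%R ->
  \sum_(n <oo) (poisson_pmf t n)%:E = 1.
Proof.
move=> t0; have := probability_setT (poisson_prob t 0%N).
rewrite /= /poisson_prob t0 -nneseries_esumT// => n.
by rewrite lee_fin poisson_pmf_ge0.
Qed.

(** From ['C(n + k, k) / (n + k)! = 1 / (n! k!)]. Summed over [n], it gives the binomial moments
    [t^k / k!] of the Poisson law. *)
Lemma poisson_pmf_bin (t : R) n k : (0 < t)%R ->
  (poisson_pmf t (n + k) * 'C(n + k, k)%:R = t ^+ k / k`!%:R * poisson_pmf t n)%R.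
Proof.
move=> t0; rewrite /poisson_pmf t0.
have := bin_fact (leq_addl n k); rewrite addnK => /(congr1 (fun m => m%:R : R)%R).
rewrite !natrM => <-.
have fn m : (m`!%:R != 0 :> R)%R by rewrite pnatr_eq0 -lt0n fact_gt0.
have bn : ('C(n + k, k)%:R != 0 :> R)%R by rewrite pnatr_eq0 -lt0n bin_gt0 leq_addl.
by rewrite exprD; field; rewrite !fn bn.
Qed.

Lemma poisson_bin_mixture (t : R) (a : nat -> R) : (0 < t)%R ->
  (forall k, 0 <= a k)%R ->
  \sum_(n <oo) (poisson_pmf t n * \sum_(k < n.+1) 'C(n, k)%:R * a k)%:E =
  \sum_(k <oo) (t ^+ k / k`!%:R * a k)%:E.
Proof.
move=> t0 a0.
pose b n k : \bar R := (poisson_pmf t n * ('C(n, k)%:R * a k))%:E.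
have b0 n k : 0 <= b n k.
  by rewrite lee_fin !mulr_ge0// poisson_pmf_ge0.
(* As ['C(n, k) = 0] for [k > n], the inner sum may run over all [k]; nonnegativity then allows
   exchanging the two sums. *)
rewrite (eq_eseriesr (g := fun n => \sum_(k <oo) b n k)); last first.
  move=> n _; rewrite (@nneseries_split _ _ 0%N n.+1)// add0n.
  rewrite [X in _ = _ + X]eseries0 ?adde0; last first.
    by move=> k nk _; rewrite /b bin_small// mul0r mulr0.
  by rewrite big_mkord mulr_sumr -sumEFin.
rewrite (nneseries_interchange predT predT b0).
apply: eq_eseriesr => k _.
(* Terms with [n < k] vanish, so the sum over [n] starts at [k] and is reindexed from [0]. *)
rewrite (@nneseries_split _ _ 0%N k)// add0n big1_seq ?add0e; last first.
  move=> n; rewrite mem_index_iota/= => nk.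
  by rewrite /b bin_small// mul0r mulr0.
rewrite -nneseries_addn//.
rewrite (eq_eseriesr (g := fun n => (t ^+ k / k`!%:R * a k)%:E * (poisson_pmf t n)%:E)).
  rewrite nneseriesZl; last by move=> *; rewrite lee_fin poisson_pmf_ge0.
  by rewrite poisson_pmf_sum1// mule1.
move=> n _; rewrite /b mulrA poisson_pmf_bin// -EFinM; congr EFin; ring.
Qed.

(** Cauchy-Schwarz for the vectors [sqrt (c k)] and [2^k sqrt (c k)], by way of a nonnegative
    quadratic polynomial. *)
Lemma sqr_sum_exp2 (c : nat -> R) n : (forall k, 0 <= c k)%R ->
  ((\sum_(0 <= k < n) c k * 2 ^+ k) ^+ 2 <=
   (\sum_(0 <= k < n) c k) * (\sum_(0 <= k < n) c k * 4 ^+ k))%R.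
Proof.
move=> c0.
set A := (\sum_(_ <= _ < _) c _)%R; set B := (\sum_(_ <= _ < _) (_ * 2 ^+ _))%R.
set C := (\sum_(_ <= _ < _) (_ * 4 ^+ _))%R.
have A0 : (0 <= A)%R by apply: sumr_ge0.
have C0 : (0 <= C)%R by apply: sumr_ge0 => k _; rewrite mulr_ge0.
have quad (x : R) : (0 <= A * x ^+ 2 - 2 * B * x + C)%R.
  rewrite [leRHS](_ : _ = \sum_(0 <= k < n) c k * (x - 2 ^+ k) ^+ 2)%R.
    by apply: sumr_ge0 => k _; rewrite mulr_ge0// sqr_ge0.
  rewrite /A /B /C mulr_suml mulr_sumr mulr_suml -sumrB -big_split/=.
  apply: eq_bigr => k _.
  have -> : (4 ^+ k = (2 ^+ k) ^+ 2 :> R)%R by rewrite exprAC; congr (_ ^+ _)%R; ring.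
  by ring.
(* If [A = 0], every [c k] with [k < n] vanishes. Otherwise the quadratic is evaluated at its
   minimiser [B / A]. *)
have [A00|Apos] := eqVneq A 0%R.
  suff -> : B = 0%R by rewrite A00 mul0r expr0n.
  rewrite /B big_seq big1// => k kn.
  suff -> : c k = 0%R by rewrite mul0r.
  apply/eqP; move/eqP : A00; rewrite /A psumr_eq0// => /allP/(_ k kn); exact.
have {A0}Apos : (0 < A)%R by rewrite lt0r Apos.
have := quad (B / A)%R.
have -> : (A * (B / A) ^+ 2 - 2 * B * (B / A) + C = (A * C - B ^+ 2) / A)%R.
  by field; rewrite gt_eqF.
by rewrite pmulr_lge0 ?invr_gt0// subr_ge0.
Qed.

Lemma nneseries_exp2_le_sqrt (t : R) (a : nat -> R) :
  let S x := \sum_(k <oo) (x ^+ k / k`!%:R * a k)%:E in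
  (0 <= t)%R -> (forall k, 0 <= a k)%R -> S (2 * t)%R <= sqrte (S t * S (4 * t)%R).
Proof.
move=> S t0 a0.
have term0 (x : R) k : (0 <= x)%R -> (0 <= x ^+ k / k`!%:R * a k)%R.
  by move=> x0; rewrite !mulr_ge0// ?invr_ge0// exprn_ge0.
have t20 : (0 <= 2 * t)%R by rewrite mulr_ge0.
have t40 : (0 <= 4 * t)%R by rewrite mulr_ge0.
have S0 (x : R) : (0 <= x)%R -> 0 <= S x.
  by move=> x0; apply: nneseries_ge0 => k _ _; rewrite lee_fin term0.
(* The series may diverge, so the bound is proved for its partial sums, which are finite. *)
apply: lime_le.
  by apply: is_cvg_nneseries => k _ _; rewrite lee_fin term0.
apply: nearW => n; rewrite sumEFin.
set p := (X in X%:E <= _).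
have p0 : (0 <= p)%R by apply: sumr_ge0 => k _; exact: term0.
rewrite -[leLHS]gee0_abs ?lee_fin// -sqrte_sqr lee_sqrt ?mule_ge0 ?S0//.
have partial (x : R) : (0 <= x)%R ->
    (\sum_(0 <= k < n) x ^+ k / k`!%:R * a k)%:E <= S x.
  move=> x0; rewrite -sumEFin; apply: nneseries_lim_ge => k _ _.
  by rewrite lee_fin term0.
(* The factors [2^k] and [4^k] are absorbed into [t^k], giving the partial sums at [2t] and [4t]. *)
have := @sqr_sum_exp2 (fun k => t ^+ k / k`!%:R * a k)%R n (fun k => term0 t k t0).
have scale (c : R) : (\sum_(0 <= k < n) t ^+ k / k`!%:R * a k * c ^+ k =
    \sum_(0 <= k < n) (c * t) ^+ k / k`!%:R * a k)%R.
  by apply: eq_bigr => k _; rewrite exprMn; ring.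
rewrite !scale -lee_fin -EFin_expe => /le_trans; apply.
by rewrite EFinM; apply: lee_pmul; rewrite ?partial// lee_fin sumr_ge0// => k _; rewrite term0.
Qed.

End PoissonMixture.

(** Ensures that distinct step sequences describe disjoint events. *)
Lemma unit_step_inj d : injective (@unit_step d).
Proof.
move=> [i b] [j c] /rowP E.
(* Coordinate [i] of the first vector is a sign, hence nonzero, which forces [i = j]. *)
have := E i; rewrite !mxE/= !eqxx mulr1.
have [<-|ij] := eqVneq i j; last by rewrite mulr0 => /eqP; rewrite signr_eq0.
by rewrite mulr1 => /signr_inj ->.
Qed.

(** * Measurability for countably valued variables *)

Section DiscreteRV.
Context {disp : measure_display} {T : measurableType disp}.

Lemma measurable_discrete_preimage (V : countType) (X : T -> V) (B : set V) :
  discrete_rv X -> measurable (X @^-1` B).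
Proof.
(* [[set _ | B v]] is the whole space or empty, so the union keeps exactly the values in [B]. *)
move=> mX; rewrite (_ : X @^-1` B = \bigcup_v ([set w | X w = v] `&` [set _ | B v])).
  apply: countable_bigcupT_measurable => [|v]; first exact: countableP.
  have [Bv|nBv] := pselect (B v).
    rewrite [X in _ `&` X](_ : _ = setT) ?setIT//.
    by apply/seteqP; split.
  rewrite [X in _ `&` X](_ : _ = set0) ?setI0//.
  by apply/seteqP; split.
by apply/seteqP; split => [w Bw|w [v _ [/= -> //]]]; exists (X w).
Qed.

Lemma discrete_rv_add (V : countZmodType) (X Z : T -> V) :
  discrete_rv X -> discrete_rv Z -> discrete_rv (fun w => X w + Z w).
Proof.
move=> mX mZ v.
rewrite (_ : mkset _ =
    \bigcup_z ([set w | X w = v - z] `&` [set w | Z w = z])).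
  apply: countable_bigcupT_measurable => [|z]; first exact: countableP.
  exact: measurableI.
apply/seteqP; split => [w /= <-|w [z _ /= [-> ->]]]; last by rewrite subrK.
by exists (Z w) => //=; rewrite addrK.
Qed.

Lemma discrete_rv_sum (V : countZmodType) (X : nat -> T -> V) n :
  (forall i, discrete_rv (X i)) -> discrete_rv (fun w => \sum_(i < n) X i w).
Proof.
move=> mX; elim: n => [|n IH].
  move=> v; under eq_set do rewrite big_ord0.
  have [->|v0] := eqVneq 0 v; first by rewrite (_ : mkset _ = setT)//; apply/seteqP; split.
  rewrite (_ : mkset _ = set0)//; apply/seteqP; split => // w /= /eqP.
  by rewrite (negbTE v0).
under eq_fun do rewrite big_ord_recr.
exact: discrete_rv_add.
Qed.

(** By splitting on the value of [N]; this covers the walk at its random number of jumps. *)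
Lemma discrete_rv_random_index (V : Type) (N : T -> nat) (X : nat -> T -> V) :
  discrete_rv N -> (forall n, discrete_rv (X n)) ->
  discrete_rv (fun w => X (N w) w).
Proof.
move=> mN mX v.
rewrite (_ : mkset _ = \bigcup_n ([set w | N w = n] `&` [set w | X n w = v])).
  by apply: bigcupT_measurable => n; apply: measurableI; [exact: mN|exact: mX].
by apply/seteqP; split => [w /= <-|w [n _ /= [-> //]]]; exists (N w).
Qed.

Lemma measurable_fun_discrete d' (T' : measurableType d') (V : countType)
    (X : T -> V) (f : V -> T') (D : set T) :
  discrete_rv X -> measurable_fun D (fun w => f (X w)).
Proof.
move=> mX mD B mB; apply: measurableI => //.
exact: (measurable_discrete_preimage (f @^-1` B) mX).
Qed.

End DiscreteRV.

(** * The expectation as a sum over jump counts and paths *)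

Section Expectation.
Context {R : realType} {d : nat} {disp : measure_display}.
Context {T : measurableType disp} {P : probability T R}.
Context {N : R -> T -> nat} {xi : nat -> T -> lattice d}.
Hypotheses (hd : (0 < d)%N) (hN : poisson_process P 1 N)
  (hxi : simple_steps P xi) (hind : independent_processes P N xi).

(* Indexed by [iota 0 n] and with a total [nth], to match the form of
   [mutually_independent] and [independent_processes]. *)
Let path n (p : n.-tuple ('I_d * bool)) : set T :=
  [set w | forall i, i \in iota 0 n ->
     xi i w = nth 0 [seq unit_step s | s <- p] i].

Let path_tnth n (p : n.-tuple ('I_d * bool)) w (i : 'I_n) :
  path p w -> xi i w = unit_step (tnth p i).
Proof.
(* An entry of [p] supplies the default value that [nth_map] asks for. *)
have s0 := tnth p i; move=> /(_ i); rewrite mem_iota ltn_ord => -> //.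
by rewrite (nth_map s0) ?size_tuple ?ltn_ord// (tnth_nth s0).
Qed.

Let pathP n (p : n.-tuple ('I_d * bool)) w :
  (forall i : 'I_n, xi i w = unit_step (tnth p i)) -> path p w.
Proof.
move=> h i; rewrite mem_iota add0n => /= ilt.
have s0 := tnth p (Ordinal ilt).
by rewrite (h (Ordinal ilt)) (nth_map s0) ?size_tuple// (tnth_nth s0).
Qed.

Let path_inj n (p q : n.-tuple ('I_d * bool)) w : path p w -> path q w -> p = q.
Proof.
move=> hp hq; apply: eq_from_tnth => i; apply: unit_step_inj.
by rewrite -(path_tnth i hp) -(path_tnth i hq).
Qed.

Let measurable_path n (p : n.-tuple ('I_d * bool)) : measurable (path p).
Proof.
rewrite (_ : path p = \bigcap_(i in [set j | j \in iota 0 n])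
   [set w | xi i w = nth 0 [seq unit_step s | s <- p] i]).
  by apply: bigcap_measurableType => i _; exact: steps_measurable hxi _ _.
by apply/seteqP; split => w h i; exact: h.
Qed.

Let measurable_jumps (t : R) n : 0 <= t -> measurable [set w | N t w = n].
Proof. by move=> t0; exact: (poisson_measurable hN). Qed.

Local Open Scope ereal_scope.

Let prob_path n (p : n.-tuple ('I_d * bool)) :
  P (path p) = (((2 * d)%:R ^- n)%R)%:E.
Proof.
rewrite (steps_independent hxi) ?iota_uniq//.
rewrite (eq_big_seq (fun=> ((2 * d)%:R^-1)%R%:E)); last first.
  move=> i; rewrite mem_iota add0n => /= ilt.
  rewrite (nth_map (tnth p (Ordinal ilt))) ?size_tuple//.
  exact: steps_law hxi _ _.
by rewrite prodEFin big_const_seq count_predT size_iota iter_mulr_1 exprVn.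
Qed.

(** [N t] is the increment from time [0], where the process vanishes. *)
Let prob_jumps (t : R) n : (0 < t)%R -> P [set w | N t w = n] = (poisson_pmf t n)%:E.
Proof.
move=> t0; have := poisson_increments_law hN n (lexx 0%R) t0.
rewrite mul1r subr0 => <-; congr (P _).
by apply/seteqP; split => w /=; rewrite (poisson_start hN) subn0.
Qed.

Let prob_path_jumps (t : R) n (p : n.-tuple ('I_d * bool)) : (0 < t)%R ->
  P (path p `&` [set w | N t w = n]) =
  (poisson_pmf t n * (2 * d)%:R ^- n)%:E.
Proof.
move=> t0.
have JE : [set w | forall s, s \in [:: t] -> N s w = n] = [set w | N t w = n].
  apply/seteqP; split => w /= h; first by apply: h; rewrite inE.
  by move=> s; rewrite inE => /eqP ->.
have := @hind [:: t] (fun=> n) (iota 0 n)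
  (fun i => nth 0%R [seq unit_step s | s <- p] i).
rewrite /= JE setIC => ->; last by move=> s; rewrite inE => /eqP ->; exact: ltW.
by rewrite prob_jumps// -[X in _ * P X]/(path p) prob_path.
Qed.

(** For each [i], the [2d] disjoint events [xi i = unit_step s] have probability [1 / (2d)] each, so
    their union has full measure. *)
Let ae_steps : {ae P, forall w, forall i, exists s, xi i w = unit_step s}.
Proof.
apply: ae_foralln => i.
pose F (s : 'I_d * bool) := [set w | xi i w = unit_step s].
have mF s : measurable (F s) by exact: steps_measurable hxi _ _.
have FE : [set w | exists s, xi i w = unit_step s] = \bigcup_(s in setT) F s.
  by apply/seteqP; split => w /= [s ? //]; exists s.
have mU : measurable (\bigcup_(s in setT) F s).
  by apply: fin_bigcup_measurable => //; exact: finite_finset.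
exists (~` \bigcup_(s in setT) F s); split; first exact: measurableC.
  apply: etrans (probability_setC P mU) _.
  rewrite measure_fin_bigcup//; first last.
  - by move=> s r _ _ [w [hs hr]]; exact/unit_step_inj/(etrans (esym hs) hr).
  - exact: finite_finset.
  rewrite (fsbigE (index_enum ('I_d * bool)%type)) ?index_enum_uniq//; last first.
    by move=> s _; rewrite mem_index_enum.
  rewrite (eq_bigl xpredT); last by move=> s; exact: mem_set.
  rewrite (eq_bigr (fun=> ((2 * d)%:R^-1)%R%:E)); last first.
    by move=> s _; exact: steps_law hxi _ _.
  rewrite sumEFin sumr_const card_prod card_ord card_bool (mulnC d).
  by rewrite -(mulr_natl _^-1) mulfV ?subee// pnatr_eq0 muln_eq0 -lt0n hd.
by rewrite -FE.
Qed.

Lemma expectation_srw (g : lattice d -> R) (t : R) : (0 < t)%R ->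
  (forall x, 0 <= g x)%R ->
  \int[P]_w (g (\sum_(i < N t w) xi i w)%R)%:E =
  \sum_(n <oo) (poisson_pmf t n * iter n neighbour_mean g 0)%:E.
Proof.
move=> t0 g0.
have mS : discrete_rv (fun w => \sum_(i < N t w) xi i w)%R.
  apply: (@discrete_rv_random_index _ _ _ (N t) (fun n w => \sum_(i < n) xi i w)%R).
    by apply: (poisson_measurable hN); exact: ltW.
  by move=> n; apply: discrete_rv_sum; exact: (steps_measurable hxi).
have mg (D : set T) :
    measurable_fun D (fun w => (g (\sum_(i < N t w) xi i w)%R)%:E).
  by apply: (measurable_fun_discrete (fun x => (g x)%:E)).
have mN n : measurable [set w | N t w = n] by apply: measurable_jumps; exact: ltW.
have -> : [set: T] = \bigcup_n [set w | N t w = n].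
  by apply/seteqP; split => // w _; exists (N t w).
rewrite ge0_integral_bigcup//; last 2 first.
- by move=> w _; rewrite lee_fin.
- by move=> m n _ _ [w [/= <- <-]].
apply: eq_eseriesr => n _.
(* On [N t = n] the integrand is almost surely a finite sum of path indicators, weighted by [g] at
   the endpoints. *)
rewrite (ge0_ae_eq_integral (g := fun w => \sum_(p : n.-tuple ('I_d * bool))
  (g (\sum_(i < n) unit_step (tnth p i)) * \1_(path p) w)%:E))//; last 4 first.
- apply: emeasurable_sum => p; apply/measurable_EFinP.
  by apply: measurable_funM => //; exact: measurable_indic.
- by move=> w _; rewrite lee_fin.
- by move=> w _; apply: sume_ge0 => p _; rewrite lee_fin mulr_ge0.
(* The realised steps form a path [q], and the indicators of all other paths vanish at [w]. *)
- apply: filterS ae_steps => w hw /= Nw.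
  have [s hs] := choice hw.
  pose q := [tuple s i | i < n].
  have hq : path q w by apply: pathP => i; rewrite tnth_mktuple.
  rewrite (bigD1 q)//= [X in _ = _ + X]big1 ?adde0.
    rewrite indicE mem_set// mulr1 Nw; congr (g _)%:E.
    by apply: eq_bigr => i _; exact: path_tnth.
  move=> p pq; rewrite indicE memNset ?mulr0// => hp.
  by move/eqP: pq; apply; exact: path_inj hp hq.
rewrite ge0_integral_sum//; last 2 first.
- move=> p; apply/measurable_EFinP.
  by apply: measurable_funM => //; exact: measurable_indic.
- by move=> p w _; rewrite lee_fin mulr_ge0.
(* The iterated mean at [0] is expanded into a sum over paths, to be matched term by term. *)
rewrite -sum_steps mulr_sumr -sumEFin; apply: eq_bigr => p _.
rewrite (@integralZl_indic _ _ _ P _ (mN n) (fun=> path p))//; last first.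
  by rewrite ltNge g0.
rewrite integral_indic// [X in _ * X](prob_path_jumps p t0).
by rewrite -EFinM add0r mulrCA mulrA.
Qed.

End Expectation.

(** * The series for the second moment and the inequality *)

Lemma Qc_series (R : realType) (d : nat) (hd : (0 < d)%N)
    (disp : measure_display) (T : measurableType disp) (P : probability T R)
    (Y : R -> T -> lattice d) (hY : continuous_time_srw P Y)
    (u : lattice d -> R) (hu : harmonic_function u) (t : R) (ht : 0 < t) :
  Qc P Y u t = (\sum_(k <oo) (t ^+ k / k`!%:R *
    iter k (@laplacian R d) (fun x => u x ^+ 2) 0)%:E)%E.
Proof.
have [N [xi [hN hxi hind YE]]] := hY.
(* The target series becomes a Poisson mixture of binomial sums, which are the iterated neighbour
   means of [u^2] at [0]. *)
rewrite /Qc unlock -poisson_bin_mixture//; last first.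
  by move=> k; exact: iter_laplacian_sqr_ge0.
under eq_integral do rewrite YE ?ltW//.
rewrite (expectation_srw hd hN hxi hind (g := fun x => u x ^+ 2))//; last first.
  by move=> x; exact: sqr_ge0.
by apply: eq_eseriesr => n _; rewrite iter_neighbour_mean.
Qed.

Theorem theorem1p10 (R : realType) (d : nat) (hd : (0 < d)%N)
    (disp : measure_display) (T : measurableType disp) (P : probability T R)
    (Y : R -> T -> lattice d) (hY : continuous_time_srw P Y)
    (u : lattice d -> R) (hu : harmonic_function u) (t : R) (ht : 0 <= t) :
  (Qc P Y u (2 * t) <= sqrte (Qc P Y u t * Qc P Y u (4 * t)))%E.
Proof.
(* The series requires a positive Poisson rate. At [t = 0] the three times coincide and the claim
   reads [q <= sqrt (q^2) = |q|]. *)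
have [<-|t0] := eqVneq 0 t.
  by rewrite !mulr0 -expe2 sqrte_sqr lee_abs.
have {t0} tpos : 0 < t by rewrite lt0r eq_sym t0.
rewrite !(Qc_series hd hY hu) ?mulr_gt0//.
by apply: nneseries_exp2_le_sqrt => // k; exact: iter_laplacian_sqr_ge0.
Qed.
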